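(* Let $k$ be a field and let $A$ be the $k$-algebra generated by $\{z,z^{-1},D,S\}$ with defining relations $$zz^{-1}=1,\ z^{-1}z=1,\ Dz=zD,\ Sz=zS,\ Dz^{-1}=z^{-1}D,\ Sz^{-1}=z^{-1}S,\ DS=zSD.$$ Let $R=k[z,z^{-1}]$ be the algebra of Laurent polynomials over $k$, and let $\sigma$ be the automorphism of the algebra $R[D]\subseteq A$ defined by $$\sigma\Big(\sum_{i=0}^l c_iD^i\Big)=\sum_{i=0}^l c_i(zD)^i,\qquad l\geq 0,\ c_i\in R.$$ Then $A=R[S,D;\sigma,0]$ is a differential difference algebra of type $(1,1)$ over $R$ (with $\sigma_1=\sigma$ and $\delta_1=0$), and $$\operatorname{GKdim}(A)=2\operatorname{GKdim}(R)+1+1=4.$$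
   Context: All algebras are unital associative $k$-algebras, $k$ a field. For a subspace $V$ of an algebra, $V^r$ is the $k$-span of all products of $r$ elements of $V$. The Gelfand-Kirillov dimension of a $k$-algebra $A$ is $\operatorname{GKdim}(A)=\sup_V\limsup_{r\to\infty}\log_r\dim_k(V^r)$, the supremum over all finite dimensional subspaces $V$ of $A$. A derivation on $R$ is a $k$-linear map $\delta:R\to R$ with $\delta(ab)=a\delta(b)+\delta(a)b$. Definition. An algebra $A$ is a differential difference algebra of type $(m,n)$, $m,n\geq 1$, over a subalgebra $R\subseteq A$, written $A=R[\mathcal{S},\mathcal{D};\sigma,\delta]$, if there exist elements $S_1,\ldots,S_m,D_1,\ldots,D_n$ in $A$ such that: (i) the set $\{S_1^{\alpha_1}\cdots S_m^{\alpha_m}D_1^{\beta_1}\cdots D_n^{\beta_n}:\alpha\in\mathbb{N}^m,\beta\in\mathbb{N}^n\}$ (with $0\in\mathbb{N}$) is a basis of $A$ as a free left $R$-module; (ii) $D_ir=rD_i+\delta_i(r)$ for $1\leq i\leq n$, $r\in R$, where $\delta_i$ is a derivation on $R$; (iii) $S_ir=\sigma_i(r)S_i$ for $1\leq i\leq m$, $r\in R$, where $\sigma_i$ is a $k$-algebra automorphism of the subalgebra $R[D_1,\ldots,D_n]\subseteq A$ (generated by $R$ and $D_1,\dots,D_n$) such that $\sigma_i|_R$ is an automorphism of $R$ and $\sigma_i(D_j)=\sum_{l=1}^n a_{ijl}D_l$ with $a_{ijl}\in R$; (iv) $S_iS_j=S_jS_i$ for $1\leq i,j\leq m$, and $D_iD_j=D_jD_i$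 for $1\leq i,j\leq n$; (v) $D_iS_j=S_j\sigma_j(D_i)$ for $1\leq i\leq n$, $1\leq j\leq m$; (vi) $\delta_i\circ\delta_j=\delta_j\circ\delta_i$ for $1\le i,j\le n$ and $\sigma_{i}\circ\sigma_{j}=\sigma_{j}\circ\sigma_{i}$ for $1\le i,j\le m$. *)

(* Defs.v *)
From HB Require Import structures.
From mathcomp Require Import all_boot all_order all_algebra.

Set Implicit Arguments.
Unset Strict Implicit.
Unset Printing Implicit Defensive.

(* presAlg k is the quotient of the free algebra k<z, z^-1, D, S> (the monoid algebra
   of the free monoid on four letters) by the two-sided ideal generated by the
   defining relations.
   The module confines the notations of monalg, which clash with those of
   mathcomp-analysis; only the k-algebra presAlg k and its universal property are
   meant to be used outside. *)
Module PresentedAlgebra.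
From mathcomp Require Import boolp generic_quotient ring_quotient monalg.
Import GRing.Theory.
Local Open Scope ring_scope.
Local Open Scope quotient_scope.

Section Def.
Variable k : fieldType.

Local Notation freeAlg := {malg k[{fmonom 'I_4}]}.

Definition letter (i : 'I_4) : freeAlg := << fmu i >>.

Definition fz : freeAlg := letter (inord 0).
Definition fzi : freeAlg := letter (inord 1).
Definition fD : freeAlg := letter (inord 2).
Definition fS : freeAlg := letter (inord 3).

Definition relators : seq freeAlg :=
  [:: fz * fzi - 1; fzi * fz - 1;
      fD * fz - fz * fD; fS * fz - fz * fS;
      fD * fzi - fzi * fD; fS * fzi - fzi * fS;
      fD * fS - fz * fS * fD].

Inductive relIdeal : freeAlg -> Prop :=
| relIdeal_gen r : r \in relators -> relIdeal r
| relIdeal0 : relIdeal 0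
| relIdealB x y : relIdeal x -> relIdeal y -> relIdeal (x - y)
| relIdealMl a x : relIdeal x -> relIdeal (a * x)
| relIdealMr a x : relIdeal x -> relIdeal (x * a).

Definition relIdealb : pred freeAlg := fun x => `[< relIdeal x >].

Lemma relIdealP x : reflect (relIdeal x) (x \in relIdealb).
Proof. exact: asboolP. Qed.

Fact relIdealb_zmod : zmod_closed relIdealb.
Proof.
split=> [|x y /relIdealP Ix /relIdealP Iy]; apply/relIdealP.
  exact: relIdeal0.
exact: relIdealB.
Qed.

HB.instance Definition _ := GRing.isZmodClosed.Build freeAlg relIdealb
  relIdealb_zmod.

Definition relIdealZ : zmodClosed freeAlg :=
  GRing.ZmodClosed.clone _ relIdealb _.

Definition presAlg : Type := {ideal_quot relIdealZ}.

HB.instance Definition _ := GRing.Zmodule.on presAlg.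
HB.instance Definition _ := EqQuotient.on presAlg.

Definition cls (x : freeAlg) : presAlg := \pi_presAlg x.

Lemma cls_eq x y : cls x = cls y <-> relIdeal (x - y).
Proof.
split=> [/eqP|Ixy].
  by rewrite -(@Quotient.idealrBE _ relIdealZ) => /relIdealP.
apply/eqP; rewrite -(@Quotient.idealrBE _ relIdealZ).
exact/relIdealP.
Qed.

Lemma cls_surj (a : presAlg) : exists x, cls x = a.
Proof. by exists (repr a); rewrite /cls reprK. Qed.

Lemma clsD x y : cls (x + y) = cls x + cls y.
Proof. by rewrite /cls !piE. Qed.

Lemma cls0 : cls 0 = 0.
Proof. by rewrite /cls !piE. Qed.

Lemma repr_cls x : relIdeal (repr (cls x) - x).
Proof. by apply/cls_eq; rewrite /cls reprK. Qed.

Definition oneA : presAlg := cls 1.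
Fact op_key : unit. Proof. exact: tt. Qed.

Definition mulA : presAlg -> presAlg -> presAlg :=
  locked_with op_key (fun a b => cls (repr a * repr b)).
Definition scaleA : k -> presAlg -> presAlg :=
  locked_with op_key (fun c a => cls (c *: repr a)).

Lemma clsM x y : mulA (cls x) (cls y) = cls (x * y).
Proof.
rewrite /mulA locked_withE; apply/cls_eq.
set a := repr _; set b := repr _.
have -> : a * b - x * y = (a - x) * b - (- (x * (b - y))).
  by rewrite opprK mulrBl mulrBr addrA subrK.
apply: relIdealB; first exact: relIdealMr (repr_cls x).
by rewrite -mulrN opprB -opprB mulrN -mulNr; exact: relIdealMl (repr_cls y).
Qed.

Lemma clsZ c x : scaleA c (cls x) = cls (c *: x).
Proof.
rewrite /scaleA locked_withE; apply/cls_eq; rewrite -scalerBr -[_ - x]mul1r scalerAl.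
exact: relIdealMl (repr_cls x).
Qed.

(* monalg declares the free algebra only as a left algebra *)
Lemma freeAlg_scaleAr c (x y : freeAlg) : c *: (x * y) = x * (c *: y).
Proof.
have central (u : freeAlg) : u * c%:MP = c%:MP * u.
  rewrite {1}malgM_def {1}malgM_def fgmulUg fgmulgU.
  by apply: eq_bigr => l _; rewrite mulrC mul1m mulm1.
by rewrite -[RHS]/(x * (c *: y)) -!mul_malgC !mulrA central.
Qed.

Section Lift.
Variables (B : algType k) (b : 'I_4 -> B).

Definition evalM (m : {fmonom 'I_4}) : B := \prod_(i <- m) b i.

Fact evalM_mmorph : mmorphism evalM.
Proof.
by split=> [x y|]; rewrite /evalM ?fmM ?big_cat // fm1 big_nil.
Qed.

HB.instance Definition _ := isMultiplicative.Build {fmonom 'I_4} B evalM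
  evalM_mmorph.

Definition eval (x : freeAlg) : B := mmap (in_alg B) evalM x.

Lemma evalD x y : eval (x + y) = eval x + eval y.
Proof. exact: raddfD. Qed.

Lemma evalB x y : eval (x - y) = eval x - eval y.
Proof. exact: raddfB. Qed.

Lemma eval0 : eval 0 = 0.
Proof. exact: raddf0. Qed.

Lemma eval1 : eval 1 = 1.
Proof. exact: mmap1. Qed.

Lemma eval_comm (g : freeAlg) (m m' : {fmonom 'I_4}) :
  GRing.comm (in_alg B (mcoeff m g)) (evalM m').
Proof. by rewrite /GRing.comm mulr_algl mulr_algr. Qed.

Lemma evalXM x y : eval (x * y) = eval x * eval y.
Proof. exact: (commr_mmap_is_multiplicative eval_comm).1. Qed.

Lemma evalZ c x : eval (c *: x) = c *: eval x.
Proof. by rewrite /eval mmapZ /= mulr_algl. Qed.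

Lemma eval_letter i : eval (letter i) = b i.
Proof.
by rewrite /eval mmapU /= scale1r mul1r /evalM fmU big_seq1.
Qed.

Hypothesis evalR : forall r, r \in relators -> eval r = 0.

Lemma eval_relIdeal x : relIdeal x -> eval x = 0.
Proof.
elim=> {x} [r /evalR // | | x y _ xE _ yE | a x _ xE | a x _ xE].
- exact: eval0.
- by rewrite evalB xE yE subr0.
- by rewrite evalXM xE mulr0.
- by rewrite evalXM xE mul0r.
Qed.

End Lift.

Lemma evalRP (B : algType k) (b : 'I_4 -> B) :
  let z := b (inord 0) in let zi := b (inord 1) in
  let D := b (inord 2) in let S := b (inord 3) in
  z * zi = 1 -> zi * z = 1 -> D * z = z * D -> S * z = z * S ->
  D * zi = zi * D -> S * zi = zi * S -> D * S = z * S * D ->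
  forall r, r \in relators -> eval b r = 0.
Proof.
move=> z zi D S E1 E2 E3 E4 E5 E6 E7.
have sub0 x y : eval b x = eval b y -> eval b (x - y) = 0.
  by move=> xy; rewrite evalB xy subrr.
have ez : eval b fz = z by exact: eval_letter.
have ezi : eval b fzi = zi by exact: eval_letter.
have eD : eval b fD = D by exact: eval_letter.
have eS : eval b fS = S by exact: eval_letter.
move=> r; rewrite !inE.
case/orP=> [/eqP-> |].
  by apply: sub0; rewrite evalXM ez ezi eval1.
case/orP=> [/eqP-> |].
  by apply: sub0; rewrite evalXM ez ezi eval1.
case/orP=> [/eqP-> |].
  by apply: sub0; rewrite [LHS]evalXM [RHS]evalXM ez eD.
case/orP=> [/eqP-> |].
  by apply: sub0; rewrite [LHS]evalXM [RHS]evalXM ez eS.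
case/orP=> [/eqP-> |].
  by apply: sub0; rewrite [LHS]evalXM [RHS]evalXM ezi eD.
case/orP=> [/eqP-> |].
  by apply: sub0; rewrite [LHS]evalXM [RHS]evalXM ezi eS.
by move/eqP->; apply: sub0; rewrite [LHS]evalXM [RHS]evalXM [eval b (fz * fS)]evalXM
  ez eS eD.
Qed.

(* The augmentation z, z^-1 |-> 1 and D, S |-> 0 shows that presAlg is nonzero. *)
Fact oneA_neq0 : oneA != 0.
Proof.
apply/eqP; rewrite -cls0 => /cls_eq; rewrite subr0.
pose b (i : 'I_4) : k^o := (i < 2)%:R.
move/(@eval_relIdeal k^o b) => /(_ _)/eqP; rewrite eval1 oner_eq0.
suff H : forall r, r \in relators -> eval b r = 0 by move/(_ H).
by apply: evalRP; rewrite /b !inordK //= ?mulr1 ?mul1r ?mulr0 ?mul0r.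
Qed.

Fact mulAA : associative mulA.
Proof.
move=> a b c.
case: (cls_surj a) (cls_surj b) (cls_surj c) => [x <-] [y <-] [w <-].
by rewrite !clsM mulrA.
Qed.

Fact mul1A : left_id oneA mulA.
Proof. by move=> a; case: (cls_surj a) => x <-; rewrite clsM mul1r. Qed.

Fact mulA1 : right_id oneA mulA.
Proof. by move=> a; case: (cls_surj a) => x <-; rewrite clsM mulr1. Qed.

Fact mulADl : left_distributive mulA +%R.
Proof.
move=> a b c.
case: (cls_surj a) (cls_surj b) (cls_surj c) => [x <-] [y <-] [w <-].
by rewrite -clsD !clsM mulrDl clsD.
Qed.

Fact mulADr : right_distributive mulA +%R.
Proof.
move=> a b c.
case: (cls_surj a) (cls_surj b) (cls_surj c) => [x <-] [y <-] [w <-].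
by rewrite -clsD !clsM mulrDr clsD.
Qed.

HB.instance Definition _ := GRing.Zmodule_isNzRing.Build presAlg
  mulAA mul1A mulA1 mulADl mulADr oneA_neq0.

Fact scaleAA a b v : scaleA a (scaleA b v) = scaleA (a * b) v.
Proof. by case: (cls_surj v) => x <-; rewrite !clsZ scalerA. Qed.

Fact scale1A : left_id 1 scaleA.
Proof. by move=> v; case: (cls_surj v) => x <-; rewrite clsZ scale1r. Qed.

Fact scaleADr : right_distributive scaleA +%R.
Proof.
move=> a u v; case: (cls_surj u) (cls_surj v) => [x <-] [y <-].
by rewrite -clsD !clsZ scalerDr clsD.
Qed.

Fact scaleADl v : {morph scaleA^~ v : a b / a + b}.
Proof. by move=> a b; case: (cls_surj v) => x <-; rewrite !clsZ scalerDl clsD. Qed.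

HB.instance Definition _ := GRing.Zmodule_isLmodule.Build k presAlg
  scaleAA scale1A scaleADr scaleADl.

Fact scaleA_mull (c : k) (u v : presAlg) : c *: (u * v) = (c *: u) * v.
Proof.
case: (cls_surj u) (cls_surj v) => [x <-] [y <-].
by rewrite -[LHS]/(scaleA c (mulA _ _)) -[RHS]/(mulA (scaleA c _) _)
           !(clsM, clsZ) scalerAl.
Qed.

HB.instance Definition _ := GRing.Lmodule_isLalgebra.Build k presAlg scaleA_mull.

Fact scaleA_mulr (c : k) (u v : presAlg) : c *: (u * v) = u * (c *: v).
Proof.
case: (cls_surj u) (cls_surj v) => [x <-] [y <-].
by rewrite -[LHS]/(scaleA c (mulA _ _)) -[RHS]/(mulA _ (scaleA c _))
           !(clsM, clsZ) freeAlg_scaleAr.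
Qed.

HB.instance Definition _ := GRing.Lalgebra_isAlgebra.Build k presAlg scaleA_mulr.

End Def.

(* The locks serve only to keep unification from unfolding too far. *)
HB.lock Definition gen_z (k : fieldType) : presAlg k := cls (fz k).
HB.lock Definition gen_zi (k : fieldType) : presAlg k := cls (fzi k).
HB.lock Definition gen_D (k : fieldType) : presAlg k := cls (fD k).
HB.lock Definition gen_S (k : fieldType) : presAlg k := cls (fS k).

Section UniversalProperty.
Variable k : fieldType.
Local Notation freeAlg := {malg k[{fmonom 'I_4}]}.
Local Notation presAlg := (presAlg k).
Local Notation gen_z := (gen_z k).
Local Notation gen_zi := (gen_zi k).
Local Notation gen_D := (gen_D k).
Local Notation gen_S := (gen_S k).

Fact presented_relations :
  [/\ gen_z * gen_zi = 1, gen_zi * gen_z = 1,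
      gen_D * gen_z = gen_z * gen_D /\ gen_S * gen_z = gen_z * gen_S,
      gen_D * gen_zi = gen_zi * gen_D /\ gen_S * gen_zi = gen_zi * gen_S
    & gen_D * gen_S = gen_z * gen_S * gen_D].
Proof.
have rel i (x y : freeAlg) : (i < 7)%N -> nth 0 (relators k) i = x - y ->
    cls x = cls y.
  by move=> lt_i E; apply/cls_eq; rewrite -E; apply/relIdeal_gen/mem_nth.
rewrite gen_z.unlock gen_zi.unlock gen_D.unlock gen_S.unlock.
split; [| |split|split|].
- exact: etrans (clsM _ _) (rel 0 (fz k * fzi k) 1 isT erefl).
- exact: etrans (clsM _ _) (rel 1 (fzi k * fz k) 1 isT erefl).
- rewrite [LHS]clsM [RHS]clsM; exact: (rel 2).
- rewrite [LHS]clsM [RHS]clsM; exact: (rel 3).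
- rewrite [LHS]clsM [RHS]clsM; exact: (rel 4).
- rewrite [LHS]clsM [RHS]clsM; exact: (rel 5).
- rewrite [LHS]clsM -[cls (fz k) * cls (fS k)]/(mulA _ _) clsM [RHS]clsM.
  exact: (rel 6).
Qed.

Fact presented_ind (P : presAlg -> Prop) :
  P 1 -> P gen_z -> P gen_zi -> P gen_D -> P gen_S ->
  (forall c x y, P x -> P y -> P (c *: x + y)) ->
  (forall x y, P x -> P y -> P (x * y)) ->
  forall x, P x.
Proof.
rewrite gen_z.unlock gen_zi.unlock gen_D.unlock gen_S.unlock.
move=> P1 Pz Pzi PD PS Plin Pmul a.
have P0 : P 0.
  by have := Plin (-1) 1 1 P1 P1; rewrite scaleN1r addNr.
case: (cls_surj a) => x <-; rewrite [x]monalgE.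
elim/big_rec: _ => [|m y _ IH]; first by rewrite cls0.
rewrite clsD.
have -> : << x@_m *g m >> = x@_m *: << m >> :> freeAlg.
  by apply/malgP => n; rewrite [RHS]mcoeffZ [in LHS]mcoeffU [in RHS]mcoeffU1 mulr_natr.
suff Pm : P (cls << m >>).
  by rewrite -clsZ; exact: (Plin _ (cls << m >>) (cls y)).
rewrite -[m]fmK; elim: (m : seq _) => [|i w IHw].
  by rewrite -fmoneE; exact: P1.
have -> : << FMonom (i :: w) >> = letter k i * << FMonom w >> :> freeAlg.
  rewrite malgM_def fgmulUU mulr1; congr << _ *g _ >>.
  by apply/eqP; rewrite fmP fmM fmU.
suff Pi : P (cls (letter k i)).
  by rewrite -clsM; exact: (Pmul (cls (letter k i)) (cls << FMonom w >>)).
have [->|->|->|->] : [\/ i = inord 0, i = inord 1, i = inord 2 | i = inord 3].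
  case: i => [[|[|[|[|//]]]]] lti; [constructor 1|constructor 2|constructor 3
  |constructor 4]; apply/val_inj; rewrite /= ?inordK //.
- exact: Pz.
- exact: Pzi.
- exact: PD.
- exact: PS.
Qed.

Fact presented_lift (B : algType k) (z zi D S : B) :
  z * zi = 1 -> zi * z = 1 -> D * z = z * D -> S * z = z * S ->
  D * zi = zi * D -> S * zi = zi * S -> D * S = z * S * D ->
  exists f : {lrmorphism presAlg -> B},
    [/\ f gen_z = z, f gen_zi = zi, f gen_D = D & f gen_S = S].
Proof.
move=> E1 E2 E3 E4 E5 E6 E7.
pose b (i : 'I_4) := nth 0 [:: z; zi; D; S] i.
have bE j : (j < 4)%N -> b (inord j) = nth 0 [:: z; zi; D; S] j.
  by move=> lt_j; rewrite /b inordK.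
have bR : forall r, r \in relators k -> eval b r = 0.
  by apply: evalRP; rewrite !bE.
pose f (a : presAlg) : B := eval b (repr a).
have f_cls x : f (cls x) = eval b x.
  by apply/subr0_eq; rewrite -evalB; exact: eval_relIdeal bR _ (repr_cls x).
have f_lin : linear f.
  move=> c u v; case: (cls_surj u) (cls_surj v) => [x <-] [y <-].
  rewrite -[c *: cls x]/(scaleA c (cls x)) clsZ -clsD !f_cls.
  by rewrite evalD evalZ.
have f_mon : monoid_morphism f.
  split=> [|u v]; first by rewrite -[1]/(cls 1) f_cls eval1.
  case: (cls_surj u) (cls_surj v) => [x <-] [y <-].
  by rewrite -[cls x * cls y]/(mulA (cls x) (cls y)) clsM !f_cls evalXM.
pose fL := GRing.isLinear.Build k presAlg B *:%R f f_lin.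
pose fM := GRing.isMonoidMorphism.Build presAlg B f f_mon.
pose F : {lrmorphism presAlg -> B} := HB.pack f fL fM.
exists F; rewrite gen_z.unlock gen_zi.unlock gen_D.unlock gen_S.unlock; split.
- exact: etrans (f_cls (fz k)) (etrans (eval_letter b _) (bE 0 isT)).
- exact: etrans (f_cls (fzi k)) (etrans (eval_letter b _) (bE 1 isT)).
- exact: etrans (f_cls (fD k)) (etrans (eval_letter b _) (bE 2 isT)).
- exact: etrans (f_cls (fS k)) (etrans (eval_letter b _) (bE 3 isT)).
Qed.

End UniversalProperty.
End PresentedAlgebra.

Export PresentedAlgebra.

From mathcomp Require Import all_classical all_reals.
From mathcomp Require Import ereal topology normedtype sequences exp.

Import Order.TTheory GRing.Theory Num.Theory.
Local Open Scope classical_set_scope.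
Local Open Scope ring_scope.

Section SubspacesAndSubalgebras.
Variables (k : fieldType) (A : algType k).
Implicit Types (V B R : set A) (f : A -> A).

Definition lspan V : set A :=
  [set x | exists (n : nat) (c : 'I_n -> k) (v : 'I_n -> A),
    (forall i, V (v i)) /\ x = \sum_i c i *: v i].

Definition is_basis (I : eqType) V (b : I -> A) : Prop :=
  lspan (range b) = V /\
  forall (s : seq I) (c : I -> k), uniq s ->
    \sum_(i <- s) c i *: b i = 0 -> forall i, i \in s -> c i = 0.

Definition has_dim V (n : nat) : Prop :=
  exists b : 'I_n -> A, is_basis V b.

(* 0 is a junk value, taken when V is not a finite-dimensional subspace. *)
Definition fdim V : nat := xget 0%N [set n | has_dim V n].

Definition setpow V (r : nat) : set A :=
  lspan [set x | exists v : 'I_r -> A,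
    (forall i, V (v i)) /\ x = \prod_i v i].

Definition is_subalgebra B : Prop :=
  [/\ B 1, (forall (c : k) x y, B x -> B y -> B (c *: x + y))
    & (forall x y, B x -> B y -> B (x * y))].

Definition subalg_gen V : set A := smallest is_subalgebra V.

(* f restricts to a k-algebra automorphism of the subalgebra B; the values of
   f outside B are irrelevant. *)
Definition is_aut_on B f : Prop :=
  [/\ set_bij B B f, f 1 = 1,
      (forall (c : k) x y, B x -> B y -> f (c *: x + y) = c *: f x + f y)
    & (forall x y, B x -> B y -> f (x * y) = f x * f y)].

Definition is_derivation_on B f : Prop :=
  [/\ (forall x, B x -> B (f x)),
      (forall (c : k) x y, B x -> B y -> f (c *: x + y) = c *: f x + f y)
    & (forall x y, B x -> B y -> f (x * y) = x * f y + f x * y)].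

Definition is_left_basis (I : eqType) R (b : I -> A) : Prop :=
  (forall x, exists (s : seq I) (c : I -> A),
     (forall i, R (c i)) /\ x = \sum_(i <- s) c i * b i) /\
  (forall (s : seq I) (c : I -> A), uniq s -> (forall i, R (c i)) ->
     \sum_(i <- s) c i * b i = 0 -> forall i, i \in s -> c i = 0).

(* Integer powers of x, where y is meant to be a two-sided inverse of x. *)
Definition zpow (x y : A) (i : int) : A :=
  match i with Posz n => x ^+ n | Negz n => y ^+ n.+1 end.

(* R is a Laurent polynomial algebra k[x, y] with y = x^-1. *)
Definition is_laurent_algebra (x y : A) R : Prop :=
  [/\ x * y = 1, y * x = 1 & is_basis R (zpow x y)].

End SubspacesAndSubalgebras.

(* The Gelfand-Kirillov dimension of the subalgebra B of A: a subspace V of B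
   has the same powers in B as in A. The terms r = 0, 1, where ln r = 0, do not
   affect the limit superior. *)
Definition GKdim (F : realType) (k : fieldType) (A : algType k) (B : set A) :
    \bar F :=
  ereal_sup [set limn_esup (fun r : nat =>
      lne ((fdim (setpow V r))%:R%:E) * ((ln (r%:R : F))^-1)%:E)%E
    | V in [set V : set A | (exists n, has_dim V n) /\ V `<=` B]].

(* sigma i and delta i are relevant only on the subalgebra R[D_1, ..., D_n] and
   on R, respectively. *)
Record is_diff_difference_algebra (k : fieldType) (A : algType k) (m n : nat)
    (R : set A) (S : 'I_m -> A) (D : 'I_n -> A)
    (sigma : 'I_m -> A -> A) (delta : 'I_n -> A -> A) : Prop := {
  dda_m_ge1 : (1 <= m)%N;
  dda_n_ge1 : (1 <= n)%N;
  dda_subalgebra : is_subalgebra R;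
  dda_basis : is_left_basis R
    (fun ab : {ffun 'I_m -> nat} * {ffun 'I_n -> nat} =>
       (\prod_(i < m) S i ^+ ab.1 i) * (\prod_(j < n) D j ^+ ab.2 j));
  dda_delta : forall i, is_derivation_on R (delta i);
  dda_D : forall i r, R r -> D i * r = r * D i + delta i r;
  dda_sigma : forall i, is_aut_on (subalg_gen (R `|` range D)) (sigma i);
  dda_sigma_R : forall i, is_aut_on R (sigma i);
  dda_sigma_D : forall i, exists a : 'I_n -> 'I_n -> A,
    (forall j l, R (a j l)) /\
    (forall j, sigma i (D j) = \sum_(l < n) a j l * D l);
  dda_S : forall i r, R r -> S i * r = sigma i r * S i;
  dda_SS : forall i j, S i * S j = S j * S i;
  dda_DD : forall i j, D i * D j = D j * D i;
  dda_DS : forall i j, D i * S j = S j * sigma j (D i);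
  dda_delta_comm : forall i j r, R r ->
    delta i (delta j r) = delta j (delta i r);
  dda_sigma_comm : forall i j x, subalg_gen (R `|` range D) x ->
    sigma i (sigma j x) = sigma j (sigma i x)
}.

(* Main.v *)
Require Import Defs.
From HB Require Import structures.
From mathcomp Require Import all_boot all_order all_algebra.
From mathcomp Require Import all_classical all_reals.
From mathcomp Require Import ereal topology normedtype sequences exp.
From mathcomp Require Import zify lra.

Set Implicit Arguments.
Unset Strict Implicit.
Unset Printing Implicit Defensive.

Import Order.TTheory GRing.Theory Num.Theory.
Local Open Scope classical_set_scope.
Local Open Scope ring_scope.

(** The monomials [z^i S^a D^b] span [A] because [D^b S^a = z^(ab) S^a D^b]; they
    are independent because [A] acts on the free module with basis [e_0, ..., e_n]
    over [k(z)[t]] by [S e_i = e_(i+1)] and [D e_i = z^i t e_i], so that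
    [S^a D^b e_0 = t^b e_a]. The automorphism [sigma] extends to all of [A] by
    fixing [S], with inverse [D |-> z^-1 D].
    A word of length [r] has degree at most [r] in [S] and in [D], but the degree in
    [z] may reach the order of [r^2], which gives [r^4] monomials at most. Conversely
    [z^t S^(m+a-q) D^m S^q D^b = z^(t+qm) S^(m+a) D^(m+b)], so for [t, q, a, b < m]
    the words of length at most [5m] yield [m^4] independent monomials. *)

(** * Linear algebra of subspaces *)

Section Spans.
Variables (k : fieldType) (A : algType k).
Implicit Types (V W X : set A).

Definition is_subspace W :=
  W 0 /\ forall (c : k) x y, W x -> W y -> W (c *: x + y).

Lemma subspace_sum W (I : Type) (s : seq I) (P : pred I) (c : I -> k)
    (v : I -> A) :
  is_subspace W -> (forall i, P i -> W (v i)) ->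
  W (\sum_(i <- s | P i) c i *: v i).
Proof.
move=> [W0 WL] Wv; elim/big_rec: _ => // i x Pi Wx; exact: WL (Wv _ Pi) Wx.
Qed.

Lemma lspan_sub X W : is_subspace W -> X `<=` W -> lspan X `<=` W.
Proof.
by move=> sW XW x [n [c [v [Xv ->]]]]; apply: subspace_sum => // i _; apply: XW.
Qed.

Lemma sub_lspan X : X `<=` lspan X.
Proof.
move=> x Xx; exists 1%N, (fun=> 1), (fun=> x); split=> //.
by rewrite big_ord1 scale1r.
Qed.

Lemma subspace_lspan X : is_subspace (lspan X).
Proof.
split.
  by exists 0%N, (fun=> 0), (fun=> 0); split; [case | rewrite big_ord0].
move=> a _ _ [n [c [v [Xv ->]]]] [m [d [w [Xw ->]]]].
exists (n + m)%N, (fun i => match fintype.split i with inl j => a * c j | inr j => d j end),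
  (fun i => match fintype.split i with inl j => v j | inr j => w j end); split.
  by move=> i; case: fintype.split.
rewrite big_split_ord scaler_sumr; congr (_ + _); apply: eq_bigr => i _.
  by rewrite (unsplitK (inl i)) scalerA.
by rewrite (unsplitK (inr i)).
Qed.

Lemma lspan_mono X W : X `<=` W -> lspan X `<=` lspan W.
Proof.
move=> XW; apply: lspan_sub; first exact: subspace_lspan.
exact: subset_trans XW (@sub_lspan _).
Qed.

Lemma lspan_range (I : finType) (v : I -> A) x :
  lspan (range v) x -> exists c : I -> k, x = \sum_i c i *: v i.
Proof.
have sW : is_subspace [set x | exists c : I -> k, x = \sum_i c i *: v i].
  split=> [|a _ _ [c ->] [d ->]].
    by exists (fun=> 0); rewrite big1 // => i _; rewrite scale0r.
  exists (fun i => a * c i + d i); rewrite scaler_sumr -big_split.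
  by apply: eq_bigr => i _; rewrite /= scalerA scalerDl.
apply: (lspan_sub sW) => _ [i _ <-]; exists (fun j => (j == i)%:R).
rewrite (bigD1 i) //= eqxx scale1r big1 ?addr0 // => j /negbTE ->.
by rewrite scale0r.
Qed.

Definition independent (I : finType) (v : I -> A) :=
  forall c : I -> k, \sum_i c i *: v i = 0 -> forall i, c i = 0.

(** Bridges to the form used in [is_basis]: coefficients on [s] are extended by 0 to the whole
    finite type. *)
Lemma independent_uniq (I : finType) (v : I -> A) : independent v <->
  forall (s : seq I) (c : I -> k), uniq s ->
    \sum_(i <- s) c i *: v i = 0 -> forall i, i \in s -> c i = 0.
Proof.
split=> [fv s c us E i si | fv c E i].
  have := fv (fun i => if i \in s then c i else 0) _ i; rewrite si; apply.
  rewrite -[RHS]E; transitivity (\sum_(i in s) c i *: v i); last by rewrite -big_uniq.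
  by rewrite [RHS]big_mkcond; apply: eq_bigr => j _; case: ifP; rewrite ?scale0r.
by apply: (fv (index_enum I)); rewrite ?index_enum_uniq ?mem_index_enum.
Qed.

(* A linear relation on more than #|J| vectors comes from the kernel of their
   coefficient matrix. *)
Lemma independent_card (I J : finType) (v : I -> A) (w : J -> A) :
  independent v -> (forall i, lspan (range w) (v i)) -> (#|I| <= #|J|)%N.
Proof.
move=> fv vw.
have [M ME] := @choice _ _ (fun i c => v i = \sum_j c j *: w j)
  (fun i => lspan_range (vw i)).
rewrite leqNgt; apply/negP => ltJI.
pose B : 'M[k]_(#|I|, #|J|) := \matrix_(i, j) M (enum_val i) (enum_val j).
have /rowV0Pn[u /sub_kermxP uB u0] : kermx B != 0.
  rewrite -mxrank_eq0 mxrank_ker subn_eq0 -ltnNge.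
  exact: leq_ltn_trans (rank_leq_col B) ltJI.
case/negP: u0; apply/eqP/rowP => i; rewrite mxE.
rewrite -[i]enum_valK; apply: (fv (fun i => u 0 (enum_rank i))).
under eq_bigr do rewrite ME scaler_sumr.
rewrite exchange_big big1 // => j _.
under eq_bigr do rewrite scalerA.
rewrite -scaler_suml.
suff -> : \sum_i u 0 (enum_rank i) * M i j = (u *m B) 0 (enum_rank j).
  by rewrite uB mxE scale0r.
rewrite mxE (reindex (@enum_val I I)) /=; last first.
  by exists enum_rank => ? _; rewrite ?enum_rankK ?enum_valK.
by apply: eq_bigr => l _; rewrite mxE enum_rankK enum_valK.
Qed.

(** If [x] had a nonzero coefficient in a relation, dividing by it would put [x] in the span. *)
Lemma independent_extend n (v : 'I_n -> A) x : independent v ->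
  ~ lspan (range v) x -> independent (fun i : 'I_n.+1 => oapp v x (unlift ord_max i)).
Proof.
move=> fv nx c; rewrite big_ord_recr /= unlift_none /=.
have E i : oapp v x (unlift ord_max (widen_ord (leqnSn n) i)) = v i.
  rewrite (_ : widen_ord _ i = lift ord_max i) ?liftK //.
  by apply: val_inj; rewrite /= /bump leqNgt ltn_ord.
under eq_bigr do rewrite E.
move=> c0; have cm : c ord_max = 0.
  apply: contrapT => /eqP nz; apply: nx.
  rewrite -[x](scalerK nz) -[c _ *: x](addKr (\sum_i c (widen_ord (leqnSn n) i) *: v i)).
  rewrite c0 addr0 -sumrN scaler_sumr.
  under eq_bigr do rewrite -scaleNr scalerA.
  by apply: subspace_sum; [exact: subspace_lspan | move=> i _; apply: sub_lspan; exists i].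
move: c0; rewrite cm scale0r addr0 => c0 i.
case: (unliftP ord_max i) => [j ->|-> //].
rewrite (_ : lift ord_max j = widen_ord (leqnSn n) j).
  exact: (fv (fun j => c (widen_ord (leqnSn n) j))).
by apply: val_inj; rewrite /= /bump leqNgt ltn_ord.
Qed.

Lemma has_dimP W n : has_dim W n <->
  exists2 v : 'I_n -> A, independent v & lspan (range v) = W.
Proof.
by split=> [[v [Wv fv]] | [v fv Wv]]; exists v => //; [apply/independent_uniq
  | split=> //; apply/independent_uniq].
Qed.

(** An independent family in [W] of maximal size spans [W], for otherwise it could be extended;
    sizes are bounded through [independent_card]. *)
Lemma has_dim_subspace W (J : finType) (w : J -> A) :
  is_subspace W -> W `<=` lspan (range w) -> exists n, has_dim W n.
Proof.
move=> sW Ww.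
pose P n := `[< exists2 v : 'I_n -> A, independent v & forall i, W (v i) >].
have P0 : exists n, P n.
  by exists 0%N; apply/asboolP; exists (fun=> 0) => [c _|] [].
have Pb n : P n -> (n <= #|J|)%N.
  case/asboolP=> v fv Wv; rewrite -[n]card_ord.
  by apply: (independent_card fv) => i; apply: Ww.
case: (ex_maxnP P0 Pb) => n /asboolP[v fv Wv] nmax.
exists n; apply/has_dimP; exists v => //; apply/seteqP; split.
  by apply: lspan_sub => // _ [i _ <-].
move=> x Wx; apply: contrapT => nx.
suff: (n.+1 <= n)%N by rewrite ltnn.
apply: nmax; apply/asboolP.
exists (fun i : 'I_n.+1 => oapp v x (unlift ord_max i)).
  exact: independent_extend.
by move=> i; case: unlift.
Qed.

Lemma has_dim_le W m n : has_dim W m -> has_dim W n -> (m <= n)%N.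
Proof.
move=> /has_dimP[v fv vW] /has_dimP[w _ wW]; rewrite -[m]card_ord -[n]card_ord.
by apply: (independent_card (w := w) fv) => i; rewrite wW -vW; apply: sub_lspan; exists i.
Qed.

Lemma fdim_has_dim W n : has_dim W n -> fdim W = n.
Proof.
move=> Wn; rewrite /fdim; case: xgetP => [m _ /= Wm|/(_ n)//].
by apply/eqP; rewrite eqn_leq !(has_dim_le Wm Wn, has_dim_le Wn Wm).
Qed.

(** The bound also covers a [W] without dimension, where [fdim] takes the junk value 0. *)
Lemma fdim_le W (J : finType) (w : J -> A) :
  W `<=` lspan (range w) -> (fdim W <= #|J|)%N.
Proof.
move=> Ww; rewrite /fdim; case: xgetP => [m _ /= /has_dimP[v fv vW]|//].
rewrite -[m]card_ord; apply: (independent_card fv) => i.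
by apply: Ww; rewrite -vW; apply: sub_lspan; exists i.
Qed.

(** Here the junk value 0 must be excluded; the finite family [w] guarantees that [W] has a
    dimension. *)
Lemma fdim_ge W (I J : finType) (v : I -> A) (w : J -> A) :
  is_subspace W -> W `<=` lspan (range w) ->
  independent v -> (forall i, W (v i)) -> (#|I| <= fdim W)%N.
Proof.
move=> sW Ww fv vW; have [n Wn] := has_dim_subspace sW Ww.
rewrite (fdim_has_dim Wn); have /has_dimP[u _ uW] := Wn.
by rewrite -[n]card_ord; apply: (independent_card (w := u) fv) => i; rewrite uW.
Qed.

(** The finitely many basis vectors of [V] lie in a common stage of the filtration, and stages are
    subspaces. *)
Lemma has_dim_sub_union V n (W : nat -> set A) : has_dim V n ->
  (forall N, is_subspace (W N)) ->
  (forall N M, (N <= M)%N -> W N `<=` W M) ->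
  (forall x, V x -> exists N, W N x) -> exists N, V `<=` W N.
Proof.
move=> /has_dimP[v _ vV] sW Wmono VW.
have Vv i : exists N, W N (v i) by apply: VW; rewrite -vV; apply: sub_lspan; exists i.
have [f fP] := choice Vv.
exists (\max_i f i)%N; rewrite -vV; apply: lspan_sub => // _ [i _ <-].
exact: Wmono (leq_bigmax i) _ (fP i).
Qed.

(** * Subalgebras and powers of subspaces *)

Lemma subalgebra_subspace B : is_subalgebra B -> is_subspace B.
Proof.
move=> [B1 BL BM]; split=> //.
by have := BL (-1) _ _ B1 B1; rewrite scaleN1r addNr.
Qed.

Lemma subalg_genP V : is_subalgebra (subalg_gen V).
Proof.
split=> [C [[] //]|c x y Bx By C CV|x y Bx By C CV];
  have Cx := Bx C CV; have Cy := By C CV; case: CV => -[C1 CL CM] _.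
  exact: CL.
exact: CM.
Qed.

Lemma lspan_mul X Y W : is_subspace W ->
  (forall x y, X x -> Y y -> W (x * y)) ->
  forall x y, lspan X x -> lspan Y y -> W (x * y).
Proof.
move=> [W0 WL] XYW x y Xx Yy.
have sL : is_subspace [set x | forall y, Y y -> W (x * y)].
  split=> [u _|c u v Wu Wv w Yw]; first by rewrite mul0r.
  by rewrite mulrDl -scalerAl; apply: WL; [exact: Wu|exact: Wv].
have sR : is_subspace [set y | W (x * y)].
  split=> [|c u v Wu Wv] /=; first by rewrite mulr0.
  by rewrite mulrDr -scalerAr; apply: WL.
apply: (lspan_sub sR _ Yy) => u Yu.
by apply: (lspan_sub sL _ Xx) => // v Xv w Yw; apply: XYW.
Qed.

(** Induction on the word length: multiplying by a vector of [V] raises the index of [W] by one. *)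
Lemma setpow_sub (V : set A) (W : nat -> set A) :
  (forall r, is_subspace (W r)) -> W 0%N 1 ->
  (forall r x v, W r x -> V v -> W r.+1 (x * v)) ->
  forall r, setpow V r `<=` W r.
Proof.
move=> sW W1 WS r; apply: lspan_sub => // _ [v [Vv ->]].
elim: r v Vv => [|r IH] v Vv; first by rewrite big_ord0.
by rewrite big_ord_recr; apply: WS => //; apply: IH.
Qed.

(* With 1 in V, short words may be padded. *)
Lemma setpow_word V r (s : seq A) : V 1 -> (forall x, x \in s -> V x) ->
  (size s <= r)%N -> setpow V r (\prod_(x <- s) x).
Proof.
move=> V1 Vs sr; apply: sub_lspan; exists (fun i : 'I_r => nth 1 s i); split.
  move=> i; case: (ltnP i (size s)) => [lt|ge]; last by rewrite nth_default.
  by apply: Vs; apply: mem_nth.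
rewrite -(big_mkord xpredT (fun i => nth 1 s i)) (big_cat_nat (n := size s)) //=.
rewrite (big_nth 1) [X in _ * X]big_nat_cond [X in _ * X]big1 ?mulr1 //.
by move=> i /andP[/andP[? _] _]; rewrite nth_default.
Qed.

End Spans.

(** * Polynomial growth *)

Section Growth.
Variable F : realType.
Import numFieldNormedType.Exports.

Lemma cvg_ln_natr : ln (n%:R : F) @[n --> \oo] --> +oo.
Proof.
apply/cvgryPge => M; have /cvgryPge/(_ (expR M)) := @cvgr_idn F.
apply: filterS => n Mn; have n0 : (0 : F) < n%:R by exact: lt_le_trans (expR_gt0 M) Mn.
by rewrite -[M]expRK ler_ln // posrE ?expR_gt0.
Qed.

(** For [n > 1] the quotient equals [ln C / ln n + d], and the first term tends to 0. *)
Lemma cvg_ln_monomial (C : F) (d : nat) : 0 < C ->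
  (ln (C * n%:R ^+ d) / ln n%:R)%:E @[n --> \oo] --> (d%:R)%:E.
Proof.
move=> C0; apply: cvg_EFin; first exact: nearW.
rewrite [X in X @ _ --> _](_ : _ = (fun n : nat => ln (C * n%:R ^+ d) / ln (n%:R : F))) //.
have lnV : (ln (n%:R : F))^-1 @[n --> \oo] --> (0 : F).
  apply/gtr0_cvgV0; last exact: cvg_ln_natr.
  by near=> n; apply: ln_gt0; rewrite ltr1n; near: n; exact: nbhs_infty_gt.
have : (ln C * (ln (n%:R : F))^-1 + d%:R) @[n --> \oo] --> (ln C * 0 + d%:R : F).
  by apply: cvgD; [apply: cvgMr | apply: cvg_cst].
rewrite mulr0 add0r; apply: cvg_trans; apply: near_eq_cvg; near=> n.
have n1 : (1 < n)%N by near: n; exact: nbhs_infty_gt.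
have n0 : (0 : F) < n%:R by rewrite ltr0n; lia.
have l0 : 0 < ln (n%:R : F) by apply: ln_gt0; rewrite ltr1n.
rewrite lnM ?posrE ?exprn_gt0 // lnXn // mulrDl -[ln _ *+ _]mulr_natl mulfK //.
exact: lt0r_neq0.
Unshelve. all: by end_near. Qed.

Lemma limn_esup_le (u v : (\bar F)^nat) (N : nat) :
  (forall n, (N <= n)%N -> (u n <= v n)%E) -> (limn_esup u <= limn_esup v)%E.
Proof.
move=> uv; rewrite !limn_esup_lim; apply: lee_lim; try exact: is_cvg_esups.
exists N => // n /= Nn; apply: ge_ereal_sup => _ [m /= nm <-].
apply: le_ereal_sup_tmp; exists (v m); first by exists m.
by apply: uv; apply: leq_trans nm.
Qed.

Lemma limn_esup_ln_monomial (C : F) (d : nat) : 0 < C ->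
  limn_esup (fun n : nat => (ln (C * n%:R ^+ d) / ln n%:R)%:E) = (d%:R)%:E.
Proof.
move=> C0; have h := @cvg_ln_monomial C d C0.
rewrite is_cvg_limn_esupE; first exact/cvg_lim.
by apply/cvg_ex; eexists; exact: h.
Qed.

Variables (k : fieldType) (A : algType k).

Lemma GKdim_le (B : set A) (d : nat) :
  (forall V n, has_dim V n -> V `<=` B -> exists C : nat, forall r, (0 < r)%N ->
     (fdim (setpow V r) <= C * r ^ d)%N) ->
  (GKdim F B <= (d%:R)%:E)%E.
Proof.
move=> H; apply: ge_ereal_sup => _ [V [[n Vn] VB] <-].
have [C HC] := H _ _ Vn VB.
(* [C] may be 0, while the comparison sequence needs a positive constant, hence [C.+1]. *)
rewrite -(@limn_esup_ln_monomial C.+1%:R d) ?ltr0n //.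
apply: (@limn_esup_le _ _ 2) => r r2.
have l0 : 0 < ln (r%:R : F) by apply: ln_gt0; rewrite ltr1n.
rewrite EFinM; apply: lee_wpmul2r; first by rewrite lee_fin invr_ge0 ltW.
have b : (fdim (setpow V r) <= C.+1 * r ^ d)%N.
  by apply: leq_trans (HC _ (ltnW r2)) _; rewrite leq_mul2r leqnSn orbT.
(* A zero dimension has logarithm [-oo], so the bound is immediate. *)
case: (posnP (fdim (setpow V r))) => [->|d0]; first by rewrite le0_lneNy ?leNye.
rewrite lne_EFin ?ltr0n // lee_fin ler_ln ?posrE ?ltr0n //.
  by rewrite -natrX -natrM ler_nat.
by rewrite mulr_gt0 ?exprn_gt0 ?ltr0n //; lia.
Qed.

(** One space [V] suffices, since [GKdim] is a supremum, and a limit superior sees only large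
    [r]. *)
Lemma GKdim_ge (B V : set A) (n d c N : nat) :
  has_dim V n -> V `<=` B ->
  (forall r, (N <= r)%N -> (r ^ d <= c * fdim (setpow V r))%N) ->
  ((d%:R)%:E <= GKdim F B)%E.
Proof.
move=> Vn VB H; apply: le_ereal_sup_tmp.
eexists; first by exists V; [split; [exists n|] | reflexivity].
rewrite -(@limn_esup_ln_monomial c.+1%:R^-1 d) ?invr_gt0 ?ltr0n //.
(* [ln r] is positive only from index 2 on. *)
apply: (@limn_esup_le _ _ (maxn 2 N)) => r; rewrite geq_max => /andP[r2 Nr].
have l0 : 0 < ln (r%:R : F) by apply: ln_gt0; rewrite ltr1n.
rewrite EFinM; apply: lee_wpmul2r; first by rewrite lee_fin invr_ge0 ltW.
have b := H _ Nr; have r0 : (0 < r ^ d)%N by rewrite expn_gt0; lia.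
have d0 : (0 < fdim (setpow V r))%N.
  by case: posnP b => // ->; rewrite muln0 leqn0 => /eqP E; rewrite E in r0.
rewrite lne_EFin ?ltr0n // lee_fin ler_ln ?posrE ?ltr0n //; last first.
  by rewrite mulr_gt0 ?invr_gt0 ?exprn_gt0 ?ltr0n //; lia.
rewrite ler_pdivrMl ?ltr0n // -natrX -natrM ler_nat.
by apply: leq_trans b _; rewrite leq_mul2r leqnSn orbT.
Qed.

End Growth.

(** * A matrix model of the presented algebra *)

(** [presented_lift] maps into [k]-algebras, whereas matrices over a polynomial ring [P] form a
    [P]-algebra; this alias carries the [k]-structure induced by [phi]. *)
Definition restr_scalars (k P : comNzRingType) (phi : {rmorphism k -> P})
  (B : algType P) : Type := B.

Section RestrictionOfScalars.
Variables (k P : comNzRingType) (phi : {rmorphism k -> P}) (B : algType P).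
Local Notation B' := (restr_scalars phi B).
HB.instance Definition _ := GRing.NzRing.on B'.

Definition restr_scale (c : k) (x : B') : B' := (phi c *: (x : B)).

Fact restr_scaleA a b v : restr_scale a (restr_scale b v) = restr_scale (a * b) v.
Proof. by rewrite /restr_scale scalerA rmorphM. Qed.
Fact restr_scale1 : left_id 1 restr_scale.
Proof. by move=> v; rewrite /restr_scale rmorph1 scale1r. Qed.
Fact restr_scaleDr : right_distributive restr_scale +%R.
Proof. by move=> a u v; rewrite /restr_scale scalerDr. Qed.
Fact restr_scaleDl v : {morph restr_scale^~ v : a b / a + b}.
Proof. by move=> a b; rewrite /restr_scale rmorphD scalerDl. Qed.
HB.instance Definition _ := GRing.Zmodule_isLmodule.Build k B'
  restr_scaleA restr_scale1 restr_scaleDr restr_scaleDl.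
Fact restr_scaleAl (c : k) (u v : B') : c *: (u * v) = (c *: u) * v.
Proof. exact: (@scalerAl P B). Qed.
HB.instance Definition _ := GRing.Lmodule_isLalgebra.Build k B' restr_scaleAl.
Fact restr_scaleAr (c : k) (u v : B') : c *: (u * v) = u * (c *: v).
Proof. exact: (@scalerAr P B). Qed.
HB.instance Definition _ := GRing.Lalgebra_isAlgebra.Build k B' restr_scaleAr.

End RestrictionOfScalars.

Section MatrixModel.
Variables (k K : fieldType) (iota : {rmorphism {poly k} -> K}) (n : nat).
Local Notation P := {poly K}.

Definition model_scalar : {rmorphism k -> P} := polyC \o iota \o polyC.
Definition model : algType k := restr_scalars model_scalar 'M[P]_n.+1.

Local Notation zeta := (iota 'X).

Definition model_z : 'M[P]_n.+1 := (zeta%:P)%:M.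
Definition model_zi : 'M[P]_n.+1 := ((zeta^-1)%:P)%:M.
Definition model_D : 'M[P]_n.+1 :=
  diag_mx (\row_i ((zeta ^+ i)%:P * 'X)).
(** The shift of basis vectors, truncated: the last one is sent to 0. *)
Definition model_S : 'M[P]_n.+1 :=
  \matrix_(i, j) (i == j.+1 :> nat)%:R.

(* The formal variable 'X records the exponent of D, so that the action on the
   first basis vector alone separates the monomials. *)
Definition model_vec (a : nat) : 'cV[P]_n.+1 := \col_i (i == a :> nat)%:R.

(** Both sides are supported on the subdiagonal, where row [j.+1] has weight [zeta ^+ j.+1] and
    column [j] has weight [zeta ^+ j]; the factor [model_z] compensates. *)
Lemma model_DS : model_D *m model_S = model_z *m model_S *m model_D.
Proof.
rewrite /model_z -scalemx1 -!scalemxAl mul1mx; apply/matrixP => i j.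
rewrite mul_mx_diag mul_diag_mx !mxE; case: eqP => [->|_]; last by rewrite mul0r !mulr0.
by rewrite mulr1 mul1r mulrA -polyCM exprS.
Qed.

Lemma model_lift : zeta != 0 -> exists f : {lrmorphism presAlg k -> model},
  [/\ f (gen_z k) = model_z, f (gen_zi k) = model_zi,
      f (gen_D k) = model_D & f (gen_S k) = model_S].
Proof.
move=> zeta_neq0; have zzi : model_z *m model_zi = 1%:M.
  by rewrite -scalar_mxM -polyCM divff.
have ziz : model_zi *m model_z = 1%:M.
  by rewrite -scalar_mxM -polyCM mulVf.
apply: (@presented_lift k model model_z model_zi model_D model_S) => //;
  try exact: scalar_mxC.
exact: model_DS.
Qed.

(** From [a = n] on both sides vanish, in agreement with the truncation. *)
Lemma model_S_vec a : model_S *m model_vec a = model_vec a.+1.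
Proof.
apply/colP => i; rewrite !mxE.
under eq_bigr do rewrite !mxE -natrM mulnb.
have [ia|ia] := eqVneq (i : nat) a.+1.
  have an : (a < n.+1)%N by have := ltn_ord i; lia.
  rewrite (bigD1 (Ordinal an)) //= ia !eqxx big1 ?addr0 // => j.
  rewrite -val_eqE /= => /negbTE ja.
  by rewrite ja andbF.
by rewrite big1 // => j _; case: (eqVneq (j : nat) a) => [->|]; rewrite ?andbF // (negbTE ia).
Qed.

Lemma model_D_vec0 : model_D *m model_vec 0 = 'X *: model_vec 0.
Proof.
apply/colP => i; rewrite mul_diag_mx !mxE; case: eqP => [->|_]; last by rewrite !mulr0.
by rewrite expr0 mul1r.
Qed.

Lemma model_SD_vec0 a b :
  (model_S ^+ a * model_D ^+ b) *m model_vec 0 = 'X^b *: model_vec a.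
Proof.
rewrite -mulmxA; transitivity (model_S ^+ a *m ('X^b *: model_vec 0)).
  congr (_ *m _); elim: b => [|b IH]; first by rewrite expr0 scale1r mul1mx.
  by rewrite exprSr -mulmxA model_D_vec0 -scalemxAr IH scalerA -exprS.
rewrite -scalemxAr; congr (_ *: _); elim: a => [|a IH]; first by rewrite mul1mx.
by rewrite exprS -mulmxA IH model_S_vec.
Qed.

End MatrixModel.

(** * Structure of the presented algebra *)

Section Structure.
Variable k : fieldType.
Local Notation A := (presAlg k).
Local Notation z := (gen_z k).
Local Notation zi := (gen_zi k).
Local Notation D := (gen_D k).
Local Notation S := (gen_S k).
Local Notation R := (subalg_gen [set z; zi] : set A).

(** * Central elements and commutation rules *)

Lemma mul_z_zi : z * zi = 1. Proof. by case: (presented_relations k). Qed.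
Lemma mul_zi_z : zi * z = 1. Proof. by case: (presented_relations k). Qed.
Lemma mul_D_S : D * S = z * S * D. Proof. by case: (presented_relations k). Qed.

(** The centralizer of [z] is a subalgebra, and the relations place every generator in it. *)
Lemma z_central (x : A) : GRing.comm z x.
Proof.
have [E1 E2 [E3 E4] [E5 E6] E7] := presented_relations k.
elim/presented_ind: x => //; try exact: commr1.
- by rewrite /GRing.comm E1 E2.
- by move=> c x y Hx Hy; rewrite /GRing.comm mulrDr mulrDl -scalerAl -scalerAr Hx Hy.
- by move=> x y; exact: commrM.
Qed.

Lemma zi_central (x : A) : GRing.comm zi x.
Proof.
rewrite /GRing.comm -[LHS]mulr1 -mul_z_zi !mulrA.
by rewrite -[zi * x * z]mulrA -(z_central x) mulrA mul_zi_z mul1r.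
Qed.

Lemma R_subalgebra : is_subalgebra R. Proof. exact: subalg_genP. Qed.
Lemma R_z : R z. Proof. by move=> B [_]; apply; left. Qed.
Lemma R_zi : R zi. Proof. by move=> B [_]; apply; right. Qed.

Lemma subalgebraX (B : set A) x n : is_subalgebra B -> B x -> B (x ^+ n).
Proof. by move=> [B1 _ BM] Bx; elim: n => // n IH; rewrite exprS; apply: BM. Qed.

Lemma R_central (c x : A) : R c -> GRing.comm c x.
Proof.
move: c; apply: smallest_sub; last by move=> _ [->|->] /=; [exact: z_central|exact: zi_central].
split=> /=.
- exact/commr_sym/commr1.
- by move=> c u v Hu Hv; rewrite /GRing.comm mulrDr mulrDl -scalerAl -scalerAr Hu Hv.
- by move=> u v /commr_sym Hu /commr_sym Hv; exact/commr_sym/commrM.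
Qed.

Lemma mul_D_SX a : D * S ^+ a = z ^+ a * S ^+ a * D.
Proof.
elim: a => [|a IH]; first by rewrite !expr0 !mulr1 mul1r.
rewrite !exprSr mulrA IH -[LHS]mulrA mul_D_S -!mulrA; congr (_ * _).
by rewrite !mulrA (z_central (S ^+ a)).
Qed.

(** Each of the [b] factors [D] crosses [S ^+ a] at the cost of the central factor [z ^+ a]. *)
Lemma mul_DX_SX a b : D ^+ b * S ^+ a = z ^+ (a * b) * S ^+ a * D ^+ b.
Proof.
elim: b => [|b IH]; first by rewrite muln0 !expr0 !mulr1 mul1r.
rewrite exprSr -mulrA mul_D_SX mulnS exprD !mulrA.
have zD : z ^+ a * D ^+ b = D ^+ b * z ^+ a.
  exact/commr_sym/commrX/commr_sym/z_central.
by rewrite -zD -[_ * D ^+ b * _]mulrA IH !mulrA.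
Qed.

(** * Monomials and the filtration by boxes *)

Definition mono (M j a b : nat) : A := zi ^+ M * z ^+ j * (S ^+ a * D ^+ b).

Lemma R_coef M j : R (zi ^+ M * z ^+ j).
Proof.
have sR := R_subalgebra; have [_ _ RM] := sR.
exact: RM (subalgebraX _ sR R_zi) (subalgebraX _ sR R_z).
Qed.

Lemma coef_mul M j M' j' :
  (zi ^+ M * z ^+ j) * (zi ^+ M' * z ^+ j') = zi ^+ (M + M') * z ^+ (j + j').
Proof.
rewrite !exprD !mulrA; congr (_ * _); rewrite -!mulrA; congr (_ * _).
exact/commr_sym/commrX/commr_sym/z_central.
Qed.

(** The same Laurent monomial over a larger denominator; this brings coefficients to the common
    denominator of a box. *)
Lemma coef_shift M j l : zi ^+ M * z ^+ j = zi ^+ (M + l) * z ^+ (j + l).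
Proof.
rewrite -coef_mul (_ : zi ^+ l * z ^+ l = 1) ?mulr1 //.
elim: l => [|l IH]; first by rewrite mulr1.
by rewrite exprSr exprS mulrA -[_ * zi * z]mulrA mul_zi_z mulr1.
Qed.

(** The extra exponent [a' * b] arises when [D ^+ b] passes [S ^+ a']; the coefficients are
    central. *)
Lemma mono_mul M j a b M' j' a' b' :
  mono M j a b * mono M' j' a' b' =
  mono (M + M') (j + j' + a' * b) (a + a') (b + b').
Proof.
have cM := coef_mul M j M' j'.
have c'S := R_central (S ^+ a * D ^+ b) (R_coef M' j').
have eS : GRing.comm (z ^+ (a' * b)) (S ^+ a).
  exact/commr_sym/commrX/commr_sym/z_central.
transitivity (zi ^+ M * z ^+ j * (zi ^+ M' * z ^+ j') *
    (S ^+ a * D ^+ b * (S ^+ a' * D ^+ b'))).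
  by rewrite /mono mulrA -[_ * (S ^+ a * D ^+ b) * _]mulrA -c'S !mulrA.
rewrite cM /mono [z ^+ (_ + a' * b)]exprD -!mulrA; congr (_ * (_ * _)).
rewrite [D ^+ b * _]mulrA mul_DX_SX -!mulrA [S ^+ a * _]mulrA -eS -mulrA.
by congr (_ * _); rewrite !exprD !mulrA.
Qed.

(* Writing the Laurent part as [z^-M z^j] with [j <= 2M] keeps exponents natural. *)
Definition box (M N : nat) : set A :=
  lspan (range (fun p : 'I_M.*2.+1 * ('I_N.+1 * 'I_N.+1) =>
    mono M p.1 p.2.1 p.2.2)).

Lemma box_mono M N j a b : (j <= M.*2)%N -> (a <= N)%N -> (b <= N)%N ->
  box M N (mono M j a b).
Proof.
move=> jM aN bN; apply: sub_lspan.
by exists (inord j, (inord a, inord b)); rewrite //= !inordK.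
Qed.

Lemma subspace_box M N : is_subspace (box M N). Proof. exact: subspace_lspan. Qed.

Lemma box_sub M N M' N' : (M <= M')%N -> (N <= N')%N -> box M N `<=` box M' N'.
Proof.
move=> MM NN; apply: lspan_sub; first exact: subspace_box.
move=> _ [[j [a b]] _ <-] /=; have [[jj aa] bb] := (ltn_ord j, ltn_ord a, ltn_ord b).
rewrite /mono (coef_shift M j (M' - M)) subnKC //.
by apply: box_mono; lia.
Qed.

(** The crossing term [a' * b] is at most [N * N']; enlarging the denominator exponent by that
    amount keeps the numerator exponent within twice the denominator's. *)
Lemma box_mul M N M' N' x y : box M N x -> box M' N' y ->
  box (M + M' + N * N') (N + N') (x * y).
Proof.
apply: lspan_mul; first exact: subspace_box.
move=> _ _ [[j [a b]] _ <-] [[j' [a' b']] _ <-] /=.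
have [[[jj aa] bb] [[jj' aa'] bb']] :=
  ((ltn_ord j, ltn_ord a, ltn_ord b), (ltn_ord j', ltn_ord a', ltn_ord b')).
rewrite mono_mul /mono (coef_shift _ _ (N * N')); apply: box_mono; try lia.
have : (a' * b <= N * N')%N by rewrite mulnC leq_mul // -ltnS.
lia.
Qed.

Lemma box_one : box 0 0 1.
Proof. by have := @box_mono 0 0 0 0 0; rewrite /mono !expr0 !mulr1; apply. Qed.

Lemma box_z : box 1 0 z.
Proof.
have := @box_mono 1 0 2 0 0; rewrite /mono !expr0 !mulr1 mulrA mul_zi_z mul1r.
by apply.
Qed.

Lemma box_zi : box 1 0 zi.
Proof. by have := @box_mono 1 0 0 0 0; rewrite /mono !expr0 !mulr1; apply. Qed.

Lemma box_S : box 0 1 S.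
Proof. by have := @box_mono 0 1 0 1 0; rewrite /mono !expr0 !mul1r mulr1; apply. Qed.

Lemma box_D : box 0 1 D.
Proof. by have := @box_mono 0 1 0 0 1; rewrite /mono !expr0 !mul1r; apply. Qed.

(** The bound [N ^ 2] on the Laurent part survives products because
    [N^2 + M^2 + N M <= (N + M)^2]. *)
Lemma box_exhaust x : exists N, box (N ^ 2) N x.
Proof.
elim/presented_ind: x => [|||||c x y [N Nx] [M My]|x y [N Nx] [M My]].
- by exists 0%N; exact: box_one.
- by exists 1%N; exact: box_sub box_z.
- by exists 1%N; exact: box_sub box_zi.
- by exists 1%N; exact: box_sub box_D.
- by exists 1%N; exact: box_sub box_S.
- exists (N + M)%N; apply: (subspace_box _ _).2.
    by apply: box_sub Nx; nia.
  by apply: box_sub My; nia.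
- by exists (N + M)%N; apply: box_sub (box_mul Nx My); nia.
Qed.

Lemma R_box x : R x -> exists M, box M 0 x.
Proof.
move: x; apply: smallest_sub.
  split=> /= [|c x y [N Nx] [M My]|x y [N Nx] [M My]].
  - by exists 0%N; exact: box_one.
  - exists (N + M)%N; apply: (subspace_box _ _).2.
      by apply: box_sub Nx; lia.
    by apply: box_sub My; lia.
  - by exists (N + M)%N; apply: box_sub (box_mul Nx My); lia.
by move=> _ [->|->] /=; exists 1%N; [exact: box_z|exact: box_zi].
Qed.

Lemma fdim_box_le M N W : W `<=` box M N -> (fdim W <= M.*2.+1 * (N.+1 * N.+1))%N.
Proof. by move/fdim_le; rewrite !card_prod !card_ord. Qed.

(** Quadratic growth in [z] reproduces itself: [(r N)^2 + N^2 + (r N) N <= ((r + 1) N)^2]. *)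
Lemma setpow_box N (V : set A) : V `<=` box (N ^ 2) N ->
  forall r, setpow V r `<=` box ((r * N) ^ 2) (r * N).
Proof.
move=> VN; apply: setpow_sub => [r||r x v xr /VN vV]; first exact: subspace_box.
  exact: box_one.
apply: box_sub (box_mul xr vV); last by lia.
nia.
Qed.

(** Without [S] and [D] no crossing term appears, so the exponent of [z] grows only linearly. *)
Lemma setpow_box0 M (V : set A) : V `<=` box M 0 ->
  forall r, setpow V r `<=` box (r * M) 0.
Proof.
move=> VN; apply: setpow_sub => [r||r x v xr /VN vV]; first exact: subspace_box.
  exact: box_one.
by apply: box_sub (box_mul xr vV); lia.
Qed.

Lemma zpowE M j : zi ^+ M * z ^+ j = zpow z zi (j%:Z - M%:Z).
Proof.
case: (leqP M j) => [Mj|jM].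
  rewrite subzn //= -[in LHS](subnK Mj) -[in LHS](add0n M) -coef_shift.
  by rewrite mul1r.
have -> : j%:Z - M%:Z = Negz (M - j).-1 by lia.
rewrite /zpow prednK ?subn_gt0 // -[in LHS](subnK (ltnW jM)) -[in LHS](add0n j).
by rewrite -coef_shift mulr1.
Qed.

Lemma zpow_coef (M : nat) (i : int) : (`|i| <= M)%N ->
  zpow z zi i = zi ^+ M * z ^+ absz (i + M%:Z).
Proof. by move=> iM; rewrite zpowE; congr zpow; lia. Qed.

Lemma R_zpow : lspan (range (zpow z zi)) = R.
Proof.
apply/seteqP; split.
  apply: lspan_sub; first exact: subalgebra_subspace R_subalgebra.
  by move=> _ [i _ <-]; rewrite (zpow_coef (leqnn _)); exact: R_coef.
move=> x /R_box[M]; apply: lspan_sub; first exact: subspace_lspan.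
move=> _ [[j [a b]] _ <-]; rewrite /mono !ord1 !expr0 !mulr1 zpowE.
by apply: sub_lspan; eexists.
Qed.

(** * Linear independence read off the matrix model *)

Section Independence.
Variables (K : fieldType) (iota : {rmorphism {poly k} -> K}).
Hypothesis iota_inj : injective iota.
Local Notation zeta := (iota 'X).

Let zeta_neq0 : zeta != 0.
Proof. by rewrite -(rmorph0 iota) (inj_eq iota_inj) polyX_eq0. Qed.

(** A Laurent polynomial in [z] acts by the scalar matrix of its value at [zeta]; the numerator is
    kept as the image of a polynomial so that injectivity of [iota] applies. *)
Lemma model_coef n (f : {lrmorphism A -> model iota n}) (I : Type) (s : seq I)
    (c : I -> k) (e : I -> nat) M :
  f z = model_z iota n -> f zi = model_zi iota n ->
  f (\sum_(i <- s) c i *: (zi ^+ M * z ^+ e i)) =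
  ((zeta ^- M * iota (\sum_(i <- s) c i *: 'X^(e i)))%:P)%:M :> 'M_n.+1.
Proof.
move=> fz fzi; transitivity (\sum_(i <- s) f (c i *: (zi ^+ M * z ^+ e i))).
  exact: raddf_sum.
rewrite !raddf_sum mulr_sumr !raddf_sum; apply: eq_bigr => i _ /=.
have fZ (a : k) x : f (a *: x) = a *: f x by exact: linearZ_LR.
have fM x y : f (x * y) = f x * f y by exact: rmorphM.
have fX x m : f (x ^+ m) = f x ^+ m by exact: rmorphXn.
rewrite fZ fM !fX fz fzi.
have zX m : model_z iota n ^+ m = ((zeta ^+ m)%:P)%:M by rewrite /model_z -!rmorphXn.
have ziX m : model_zi iota n ^+ m = ((zeta ^- m)%:P)%:M.
  by rewrite /model_zi -exprVn -!rmorphXn.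
rewrite -[LHS]/((iota (c i)%:P)%:P *: (model_zi iota n ^+ M *m model_z iota n ^+ e i)).
rewrite zX ziX -scalar_mxM scale_scalar_mx -!polyCM -mul_polyC.
have -> : iota ((c i)%:P * 'X^(e i)) = iota (c i)%:P * zeta ^+ e i by rewrite rmorphM rmorphXn.
by rewrite mulrCA.
Qed.

Lemma poly_sum_inj (I : eqType) (s : seq I) (c : I -> k) (e : I -> nat) :
  uniq s -> {in s &, injective e} -> \sum_(i <- s) c i *: 'X^(e i) = 0 ->
  forall i, i \in s -> c i = 0.
Proof.
move=> us es s0 i si; have := congr1 (fun p : {poly k} => p`_(e i)) s0.
rewrite coef0 coef_sum (big_rem i) //= coefZ coefXn eqxx mulr1.
rewrite big_seq big1 ?addr0 // => j; rewrite (mem_rem_uniq i us) => /andP[/= ji sj].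
rewrite coefZ coefXn; case: eqP => [/(es _ _ si sj) ij|_]; last by rewrite mulr0.
by rewrite ij eqxx in ji.
Qed.

Lemma laurent_independent_aux (I : eqType) (s : seq I) (c : I -> k) (e : I -> nat) M :
  uniq s -> {in s &, injective e} ->
  \sum_(i <- s) c i *: (zi ^+ M * z ^+ e i) = 0 -> forall i, i \in s -> c i = 0.
Proof.
move=> us es s0; apply: poly_sum_inj us es _.
(* Matrices of size 1 suffice, as only powers of [zeta] matter here. *)
have [f [fz fzi _ _]] := model_lift 0 zeta_neq0.
have := model_coef s c e M fz fzi; rewrite s0 raddf0.
move=> /matrixP/(_ 0 0); rewrite !mxE eqxx mulr1n => /esym/eqP.
rewrite polyC_eq0 mulf_eq0 invr_eq0 expf_eq0 (negbTE zeta_neq0) andbF /=.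
by rewrite -(rmorph0 iota) (inj_eq iota_inj) => /eqP.
Qed.

(** Elements of [R] act by scalars, and faithfully since [zeta] is nonzero and [iota] injective. *)
Lemma model_R n (f : {lrmorphism A -> model iota n}) x :
  f z = model_z iota n -> f zi = model_zi iota n -> R x ->
  exists2 q : K, f x = (q%:P)%:M :> 'M_n.+1 & q = 0 -> x = 0.
Proof.
move=> fz fzi /R_box[M /lspan_range[c xE]].
have {}xE : x = \sum_(i < M.*2.+1) c (i, (ord0, ord0)) *: (zi ^+ M * z ^+ i).
  transitivity (\sum_(i < M.*2.+1) \sum_(p : 'I_1 * 'I_1)
      c (i, p) *: mono M i p.1 p.2).
    by rewrite pair_big xE; apply: eq_bigr => -[].
  apply: eq_bigr => i _; rewrite (big_pred1 (ord0, ord0)) => [|[a b]].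
    by rewrite /mono /= !expr0 !mulr1.
  by rewrite /= !ord1 eqxx.
eexists; first by rewrite xE (model_coef _ _ (@nat_of_ord _) M fz fzi).
move=> /eqP; rewrite mulf_eq0 invr_eq0 expf_eq0 (negbTE zeta_neq0) andbF /=.
rewrite -(rmorph0 iota) (inj_eq iota_inj) => /eqP /poly_sum_inj c0.
rewrite xE big1 // => i _; rewrite c0 ?scale0r ?mem_index_enum ?index_enum_uniq //.
by move=> ? ? _ _; exact: val_inj.
Qed.

(** Applied to [e_0], the term of index [j] becomes a scalar multiple of ['X^(b j)] times [e_(a j)].
    Row [a i] and coefficient [b i] isolate the term of index [i], as the pairs of exponents are
    distinct. *)
Lemma SD_independent_aux (I : eqType) (s : seq I) (c : I -> A) (a b : I -> nat) :
  uniq s -> {in s &, forall i j, a i = a j -> b i = b j -> i = j} ->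
  (forall i, R (c i)) -> \sum_(i <- s) c i * (S ^+ a i * D ^+ b i) = 0 ->
  forall i, i \in s -> c i = 0.
Proof.
move=> us inj Rc s0 i si.
(* The size [(a i).+1] is the least in which [e_(a i)] survives; it is then the last basis vector,
   whence [ord_max] below. *)
have [f [fz fzi fD fS]] := model_lift (a i) zeta_neq0.
have cE (j : I) : exists q : K, f (c j) = (q%:P)%:M :> 'M_((a i).+1) /\ (q = 0 -> c j = 0).
  by have [q] := model_R fz fzi (Rc j); exists q.
have [q qE] := choice cE.
have := congr1 (fun M : 'M_((a i).+1) => ((M *m model_vec K (a i) 0) ord_max 0)`_(b i))
  (congr1 f s0 : _ = _ :> 'M_((a i).+1)).
have vE j : (f (c j * (S ^+ a j * D ^+ b j)) : 'M_((a i).+1)) *m model_vec K (a i) 0 =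
    ((q j)%:P * 'X^(b j)) *: model_vec K (a i) (a j).
  have fM x y : f (x * y) = f x * f y by exact: rmorphM.
  have fX x m : f (x ^+ m) = f x ^+ m by exact: rmorphXn.
  rewrite !fM !fX fS fD (qE j).1.
  by rewrite -[LHS]mulmxA model_SD_vec0 mul_scalar_mx scalerA.
have -> : f (\sum_(j <- s) c j * (S ^+ a j * D ^+ b j)) =
    \sum_(j <- s) f (c j * (S ^+ a j * D ^+ b j)) by exact: raddf_sum.
have -> : f 0 = 0 by exact: raddf0.
rewrite mulmx_suml (eq_bigr _ (fun j _ => vE j)) mul0mx mxE coef0.
rewrite summxE coef_sum (big_rem i) //= !mxE eqxx mulr1 coefCM coefXn eqxx mulr1.
rewrite big_seq big1 ?addr0 => [|j]; first exact: (qE i).2.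
rewrite (mem_rem_uniq i us) => /andP[/= ji sj]; rewrite !mxE.
have [aij|] := eqVneq (a i) (a j); last by rewrite mulr0 coef0.
rewrite mulr1 coefCM coefXn; case: eqP => [bij|_]; last by rewrite mulr0.
by rewrite (inj _ _ si sj aij bij) eqxx in ji.
Qed.

End Independence.

(** The embedding of [k[X]] into its fraction field serves as [iota]. *)
Let tofrac_inj : injective (@tofrac {poly k}).
Proof. by move=> p q /eqP; rewrite tofrac_eq => /eqP. Qed.

Definition laurent_independent := laurent_independent_aux tofrac_inj.
Definition SD_independent := SD_independent_aux tofrac_inj.

(** * Laurent structure of [R], the automorphism [sigma] and the differential difference
    structure *)

Lemma presAlg_lrmorphism_id (f g : {lrmorphism A -> A}) :
  f (g z) = z -> f (g zi) = zi -> f (g D) = D -> f (g S) = S -> cancel g f.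
Proof.
move=> Ez Ezi ED ES x; elim/presented_ind: x => //.
- by rewrite !rmorph1.
- by move=> c x y Ex Ey; rewrite !linearP; congr (_ *: _ + _).
- by move=> x y Ex Ey; rewrite !rmorphM; congr (_ * _).
Qed.

Lemma subalg_gen_stable (X Y : set A) (f : {lrmorphism A -> A}) :
  (forall x, X x -> subalg_gen Y (f x)) ->
  forall x, subalg_gen X x -> subalg_gen Y (f x).
Proof.
move=> XY; apply: smallest_sub => //.
have [Y1 YL YM] := subalg_genP Y; split=> /= [|c x y Yx Yy|x y Yx Yy].
- by rewrite rmorph1.
- by rewrite linearP; exact: YL.
- by rewrite rmorphM; exact: YM.
Qed.

Lemma lrmorphism_aut_on (B : set A) (f g : {lrmorphism A -> A}) :
  cancel f g -> cancel g f -> (forall x, B x -> B (f x)) ->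
  (forall x, B x -> B (g x)) -> is_aut_on B f.
Proof.
move=> fK gK Bf Bg; split.
- split=> [x Bx|x y _ _ E|x Bx]; first exact: Bf.
    by rewrite -[x]fK E fK.
  by exists (g x); [exact: Bg|exact: gK].
- exact: rmorph1.
- by move=> c x y _ _; exact: linearP.
- by move=> x y _ _; exact: rmorphM.
Qed.

Lemma lrmorphism_fix_R (f : {lrmorphism A -> A}) :
  f z = z -> f zi = zi -> forall x, R x -> f x = x.
Proof.
move=> fz fzi; apply: smallest_sub; last by move=> _ [->|->].
split=> /= [|c x y Ex Ey|x y Ex Ey]; first exact: rmorph1.
  by rewrite linearP; congr (_ *: _ + _).
by rewrite rmorphM; congr (_ * _).
Qed.

Lemma laurent_R : is_laurent_algebra z zi R.
Proof.
split; [exact: mul_z_zi | exact: mul_zi_z | split; first exact: R_zpow].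
(* [M] bounds the finitely many exponents, so that all powers share the denominator [zi ^+ M]. *)
move=> s c us s0; pose M := \max_(i <- s) absz i.
have iM i : i \in s -> (absz i <= M)%N by move=> si; exact: leq_bigmax_seq.
apply: (@laurent_independent _ _ c (fun i => absz (i + M%:Z)) M us).
  by move=> i j /iM ? /iM ? /=; lia.
rewrite -[RHS]s0 big_seq [RHS]big_seq; apply: eq_bigr => i /iM.
by move/zpow_coef ->.
Qed.

Local Notation basisSD := (fun ab : {ffun 'I_1 -> nat} * {ffun 'I_1 -> nat} =>
  (\prod_(i < 1) S ^+ ab.1 i) * (\prod_(j < 1) D ^+ ab.2 j)).

Lemma left_basis_SD : is_left_basis R basisSD.
Proof.
split=> [x|s c us Rc s0].
  have [N /lspan_range[c xE]] := box_exhaust x.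
  (* The coefficient of [S ^+ a * D ^+ b] collects the terms over all powers of [z]. *)
  pose r a b := \sum_j c (j, (a, b)) *: (zi ^+ (N ^ 2) * z ^+ j).
  have Rr a b : R (r a b).
    apply: subspace_sum; first exact: subalgebra_subspace R_subalgebra.
    by move=> *; exact: R_coef.
  exists [seq ([ffun=> nat_of_ord p.1], [ffun=> nat_of_ord p.2]) |
    p <- enum {: 'I_N.+1 * 'I_N.+1}].
  (* The coefficient function must be total with values in [R]; on the listed pairs [inord] returns
     the exponents themselves. *)
  exists (fun ab : {ffun 'I_1 -> nat} * {ffun 'I_1 -> nat} => r (inord (ab.1 ord0)) (inord (ab.2 ord0))); split=> //.
  rewrite big_map big_enum /= xE.
  transitivity (\sum_j \sum_(p : 'I_N.+1 * 'I_N.+1) c (j, p) *: mono (N ^ 2) j p.1 p.2).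
    by rewrite pair_big; apply: eq_bigr => -[].
  rewrite exchange_big; apply: eq_bigr => -[a b] _.
  rewrite !big_ord1 !ffunE !inord_val mulr_suml; apply: eq_bigr => j _.
  by rewrite scalerAl.
apply: (@SD_independent _ _ c (fun ab : {ffun 'I_1 -> nat} * {ffun 'I_1 -> nat} => ab.1 ord0)
  (fun ab => ab.2 ord0)) => //.
  move=> [a b] [a' b'] _ _ /= aa bb; congr (_, _);
  by apply/ffunP => i; rewrite ord1.
by rewrite -[RHS]s0; apply: eq_bigr => i _; rewrite !big_ord1.
Qed.

Lemma sigma_exists : exists sigma tau : {lrmorphism A -> A},
  [/\ cancel sigma tau, cancel tau sigma,
      [/\ sigma z = z, sigma zi = zi & sigma D = z * D] &
      [/\ tau z = z, tau zi = zi & tau D = zi * D]].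
Proof.
have [E1 E2 [E3 E4] [E5 E6] E7] := presented_relations k.
(* Rescaling [D] by a central [c] preserves every defining relation; [c = z] gives [sigma] and
   [c = zi] its inverse. *)
have lift c : R c -> exists f : {lrmorphism A -> A},
    [/\ f z = z, f zi = zi, f D = c * D & f S = S].
  move=> Rc; have cC x := R_central x Rc.
  apply: presented_lift => //.
  - by rewrite -mulrA E3 !mulrA cC.
  - by rewrite -mulrA E5 !mulrA cC.
  - rewrite -[LHS]mulrA E7 [LHS]mulrA (cC (z * S)). by rewrite -!mulrA.
have [f [fz fzi fD fS]] := lift z R_z.
have [g [gz gzi gD gS]] := lift zi R_zi.
exists f, g; split=> //.
- apply: presAlg_lrmorphism_id; rewrite ?fz ?fzi ?fD ?fS //.
  by rewrite [LHS]rmorphM /= gz gD mulrA E1 mul1r.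
- apply: presAlg_lrmorphism_id; rewrite ?gz ?gzi ?gD ?gS //.
  by rewrite [LHS]rmorphM /= fzi fD mulrA E2 mul1r.
Qed.

Lemma presAlg_diff_difference : exists sigma : A -> A,
  (forall (l : nat) (c : nat -> A), (forall i, R (c i)) ->
     sigma (\sum_(i < l.+1) c i * D ^+ i) = \sum_(i < l.+1) c i * (z * D) ^+ i) /\
  is_diff_difference_algebra R (fun _ : 'I_1 => S) (fun _ : 'I_1 => D)
       (fun _ : 'I_1 => sigma) (fun _ : 'I_1 => (fun _ => 0)).
Proof.
have [f [g [fK gK [fz fzi fD] [gz gzi gD]]]] := sigma_exists.
have fR := lrmorphism_fix_R fz fzi; have gR := lrmorphism_fix_R gz gzi.
(* Applied to [sigma] and to its inverse, so that [sigma] restricts to a bijection of the subalgebra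
   generated by [R] and [D]. *)
have stable (c : A) (h : {lrmorphism A -> A}) : R c -> h z = z -> h zi = zi -> h D = c * D ->
    forall x, subalg_gen (R `|` range (fun=> D : A)) x ->
      subalg_gen (R `|` range (fun _ : 'I_1 => D)) (h x).
  move=> Rc hz hzi hD; apply: subalg_gen_stable => x [Rx|[_ _ <-]].
    by rewrite (lrmorphism_fix_R hz hzi Rx); apply: sub_gen_smallest; left.
  rewrite hD; have [_ _ GM] := subalg_genP (R `|` range (fun _ : 'I_1 => D)).
  by apply: (GM _ _); apply: sub_gen_smallest; [left | right; exists ord0].
exists f; split=> [l c Rc|].
  rewrite raddf_sum; apply: eq_bigr => i _.
  by rewrite /= [LHS]rmorphM [X in _ * X]rmorphXn /= fD fR.
split=> //.
- exact: R_subalgebra.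
- exact: left_basis_SD.
- have [R0 _] := subalgebra_subspace R_subalgebra.
  by move=> _; split=> // *; rewrite ?scaler0 ?mulr0 ?mul0r addr0.
- by move=> _ r Rr; rewrite addr0 -(R_central _ Rr).
- move=> _; apply: (lrmorphism_aut_on fK gK).
    exact: stable R_z fz fzi fD.
  exact: stable R_zi gz gzi gD.
- by move=> _; apply: (lrmorphism_aut_on fK gK) => x Rx; rewrite ?fR ?gR.
- move=> _; exists (fun _ _ => z); split=> [_ _|_]; first exact: R_z.
  by rewrite big_ord1 fD.
- by move=> _ r Rr; rewrite fR // (R_central _ Rr).
(* As [sigma D = z * D] with [z] central, the required [D * S = S * sigma D] is the relation
   [mul_D_S]. *)
- move=> _ _; rewrite fD mulrA -(z_central S); exact: mul_D_S.
Qed.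

(** * Gelfand-Kirillov dimensions of [R] and [A] *)

Lemma SzD_independent (n p q : nat) :
  independent (fun i : 'I_n * ('I_p * 'I_p) =>
    z ^+ i.1 * (S ^+ (q + i.2.1) * D ^+ (q + i.2.2)) : A).
Proof.
move=> c s0 [t0 u0].
(* Grouping by the exponents of [S] and [D] reduces to independence over [R], then to that of the
   powers of [z]. *)
pose r u : A := \sum_(t < n) c (t, u) *: (zi ^+ 0 * z ^+ t).
have Rr u : R (r u).
  apply: subspace_sum; first exact: subalgebra_subspace R_subalgebra.
  by move=> *; exact: R_coef.
have r0 : r u0 = 0.
  apply: (@SD_independent _ (index_enum _) r (fun u : 'I_p * 'I_p => q + u.1)%N
    (fun u => q + u.2)%N) => //; rewrite ?index_enum_uniq ?mem_index_enum //.
    by move=> [a b] [a' b'] _ _ /= /addnI/val_inj -> /addnI/val_inj ->.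
  rewrite -[RHS]s0; under eq_bigr do rewrite /r mulr_suml.
  rewrite exchange_big pair_big /=; apply: eq_bigr => -[t u] _ /=.
  by rewrite mul1r scalerAl.
apply: (@laurent_independent _ (index_enum _) (fun t : 'I_n => c (t, u0))
  (fun t => t : nat) 0 _ _ r0); rewrite ?index_enum_uniq ?mem_index_enum //.
by move=> ? ? _ _; exact: val_inj.
Qed.

Lemma fin_dim_span (s : seq A) : exists n, has_dim (lspan [set x | x \in s]) n.
Proof.
apply: (@has_dim_subspace _ _ _ 'I_(size s) (fun i => s`_i)).
  exact: subspace_lspan.
by apply: lspan_mono => x /= /(nthP 0) [i lti <-]; exists (Ordinal lti).
Qed.

(** A box containing the power of [V] provides the finite spanning family required by [fdim_ge]. *)
Lemma fdim_setpow_ge (V : set A) n r (I : finType) (v : I -> A) :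
  has_dim V n -> independent v -> (forall i, setpow V r (v i)) ->
  (#|I| <= fdim (setpow V r))%N.
Proof.
move=> Vn fv Vv.
have [M VM] : exists M, V `<=` box (M ^ 2) M.
  apply: (has_dim_sub_union Vn) => [M|M M' MM'|x _]; last exact: box_exhaust.
    exact: subspace_box.
  by apply: box_sub; rewrite ?leq_sqr.
by apply: (fdim_ge _ (setpow_box VM (r := r)) fv) => //; exact: subspace_lspan.
Qed.

Variable F : realType.

Lemma GKdim_R : GKdim F R = 1%:E.
Proof.
apply/eqP; rewrite eq_le; apply/andP; split.
  apply: (@GKdim_le F k A R 1) => V n Vn VR.
  have [M VM] : exists M, V `<=` box M 0.
    apply: (has_dim_sub_union Vn) => [M|M M' MM'|x /VR]; last exact: R_box.
      exact: subspace_box.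
    exact: box_sub.
  exists M.*2.+1 => r r0; have := fdim_box_le (setpow_box0 VM (r := r)).
  by move/leq_trans; apply; nia.
(* Lower bound: words of length [r] in 1 and [z] include [z ^+ i] for [i < r]. *)
have [n Vn] := fin_dim_span [:: 1; z].
apply: (@GKdim_ge F k A R _ n 1 1 0 Vn).
  apply: lspan_sub; first exact: subalgebra_subspace R_subalgebra.
  have [R1 _ _] := R_subalgebra.
  by move=> x; rewrite /= !inE => /orP[]/eqP ->; [exact: R1 | exact: R_z].
move=> r _; rewrite expn1 mul1n -[r]card_ord.
apply: (@fdim_setpow_ge _ _ _ _ (fun i : 'I_r => z ^+ i) Vn).
  move=> c c0 i; apply: (@laurent_independent _ (index_enum _) c (fun t : 'I_r => t : nat) 0);
    rewrite ?index_enum_uniq ?mem_index_enum //.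
    by move=> ? ? _ _; exact: val_inj.
  by rewrite -[RHS]c0; apply: eq_bigr => j _; rewrite mul1r.
move=> i; have -> : z ^+ i = \prod_(x <- nseq i z) x.
  by rewrite big_nseq iter_mulr_1.
apply: setpow_word; rewrite ?size_nseq ?card_ord; last exact: ltnW.
  by apply: sub_lspan; rewrite /= inE eqxx.
by move=> x /nseqP[-> _]; apply: sub_lspan; rewrite /= !inE eqxx orbT.
Qed.

Lemma GKdim_A : GKdim F [set: A] = 4%:E.
Proof.
apply/eqP; rewrite eq_le; apply/andP; split.
  apply: (@GKdim_le F k A [set: A] 4) => V n Vn _.
  have [M VM] : exists M, V `<=` box (M ^ 2) M.
    apply: (has_dim_sub_union Vn) => [M|M M' MM'|x _]; last exact: box_exhaust.
      exact: subspace_box.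
    by apply: box_sub; rewrite ?leq_sqr.
  (* The box for [r] has [(2 (r M)^2 + 1) (r M + 1)^2] monomials, and [r >= 1] lets each factor
     absorb its added 1. *)
  exists ((M ^ 2).*2.+1 * (M.+1 * M.+1))%N => r r0.
  have /leq_trans := fdim_box_le (setpow_box VM (r := r)); apply.
  rewrite (_ : r ^ 4 = r ^ 2 * (r * r))%N; last by rewrite mulnn -expnD.
  rewrite mulnACA; apply: leq_mul; first by rewrite expnMn; nia.
  by rewrite mulnACA; apply: leq_mul; nia.
have [n Vn] := fin_dim_span [:: 1; z; S; D].
apply: (@GKdim_ge F k A _ _ n 4 (9 ^ 4) 5 Vn) => // r r5.
(* Words of length at most [5 m] fit into [r] letters. For [r >= 5] one has [r <= 5 m + 4 <= 9 m],
   which gives the constant [9 ^ 4]. *)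
pose m := (r %/ 5)%N.
have m0 : (0 < m)%N by rewrite divn_gt0.
have m5 : (m * 5 <= r)%N by exact: leq_divM.
have rm : (r <= 9 * m)%N by have := ltn_ceil r (isT : 0 < 5)%N; rewrite -/m; lia.
apply: (@leq_trans ((9 * m) ^ 4)); first by rewrite leq_exp2r.
rewrite expnMn leq_mul2l /=.
have -> : (m ^ 4 = #|{: 'I_(m * m) * ('I_m * 'I_m)}|)%N.
  by rewrite !card_prod !card_ord !expnS expn0 muln1 mulnA.
apply: (fdim_setpow_ge Vn (@SzD_independent _ _ m)) => -[t [a b]] /=.
(* With [t = q * m + t'], moving [D ^+ m] past [S ^+ q] produces [z ^+ (q * m)], so only [t' < m]
   letters [z] are spelled out. *)
have tm : (t %/ m < m)%N by rewrite ltn_divLR.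
have tm' : (t %% m < m)%N by rewrite ltn_mod.
set q := (t %/ m)%N in tm; set t' := (t %% m)%N in tm'.
have -> : z ^+ t * (S ^+ (m + a) * D ^+ (m + b)) =
    \prod_(x <- nseq t' z ++ nseq (m + a - q) S ++ nseq m D ++ nseq q S ++ nseq b D) x.
  have -> : z ^+ t = z ^+ t' * z ^+ (q * m) by rewrite -exprD addnC -divn_eq.
  have -> : S ^+ (m + a) = S ^+ (m + a - q) * S ^+ q by rewrite -exprD subnK //; lia.
  have zS : S ^+ (m + a - q) * z ^+ (q * m) = z ^+ (q * m) * S ^+ (m + a - q).
    exact/commrX/commr_sym/z_central.
  rewrite !big_cat /= !big_nseq !iter_mulr_1 [D ^+ m * _]mulrA mul_DX_SX exprD.
  by rewrite -!mulrA; congr (_ * _); rewrite !mulrA -zS.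
apply: setpow_word => [|x|].
- by apply: sub_lspan; rewrite /= inE eqxx.
- rewrite !mem_cat => xs; apply: sub_lspan; rewrite /= !inE.
  by case/or4P: xs => [|||/orP[]] /nseqP[-> _]; rewrite eqxx ?orbT.
(* The length is [t' + 2 m + a + b], below [5 m]. *)
- by rewrite !size_cat !size_nseq; have := ltn_ord a; have := ltn_ord b; lia.
Qed.

End Structure.

Theorem mainTheorem3 (F : realType) (k : fieldType) :
  let z := gen_z k in let zi := gen_zi k in
  let D := gen_D k in let S := gen_S k in
  let R : set (presAlg k) := subalg_gen [set z; zi] in
  is_laurent_algebra z zi R /\
  (exists sigma : presAlg k -> presAlg k,
     (forall (l : nat) (c : nat -> presAlg k), (forall i, R (c i)) ->
        sigma (\sum_(i < l.+1) c i * D ^+ i) =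
        \sum_(i < l.+1) c i * (z * D) ^+ i) /\
     is_diff_difference_algebra R (fun _ : 'I_1 => S) (fun _ : 'I_1 => D)
       (fun _ : 'I_1 => sigma) (fun _ : 'I_1 => (fun _ => 0))) /\
  GKdim F [set: presAlg k] = (2%:E * GKdim F R + 1 + 1)%E /\
  (2%:E * GKdim F R + 1 + 1)%E = 4%:E :> \bar F.
Proof.
move=> z zi D S R.
have E : (2%:E * GKdim F R + 1 + 1)%E = 4%:E :> \bar F.
  rewrite GKdim_R mule1 -!EFinD; congr (_%:E); lra.
split; first exact: laurent_R.
split; first exact: presAlg_diff_difference.
by rewrite E; split=> //; exact: GKdim_A.
Qed.
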